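(* Let $m,n\geq1$ be integers with $d=m+n\geq3$, let $\Theta$ be a real $n\times m$ matrix, and let $\underline\Psi_p,\overline\Psi_p$ be as in the context. Suppose that the group of integer solutions $(\vec x,\vec y)\in\mathbb Z^m\oplus\mathbb Z^n$ of $\Theta\vec x=\vec y$ is not a one-dimensional lattice. Then \[ \underline\Psi_2\leq 2\underline\Psi_1+d\cdot\frac{\overline\Psi_1-\underline\Psi_1}{n+n\overline\Psi_1}\quad\text{if }\ \overline\Psi_1\neq-1, \] and \[ \underline\Psi_2\leq 2\underline\Psi_1+d\cdot\frac{\overline\Psi_1-\underline\Psi_1}{m-n\overline\Psi_1}. \]
   Context: Let $T=\begin{pmatrix}E_m&0\\ \Theta&E_n\end{pmatrix}$ ($E_k$ the $k\times k$ identity matrix) and $\Lambda=T^{-1}\mathbb Z^d$. For $s>0$ let $\boldsymbol\tau(s)\in\mathbb R^d$ be given by $\tau_1(s)=\cdots=\tau_m(s)=s$, $\tau_{m+1}(s)=\cdots=\tau_d(s)=-ms/n$, let $D_{\boldsymbol\tau(s)}$ be the diagonal matrix with diagonal entries $e^{\tau_1(s)},\ldots,e^{\tau_d(s)}$, and $\mathcal B(s)=D_{\boldsymbol\tau(s)}[-1,1]^d$. For a compact origin-symmetric convex body $M$, $\lambda_p(M)$ is its $p$-th successive minimum with respect to $\Lambda$ (the infimum of $\lambda>0$ such that $\lambda M$ contains $p$ linearly independent points of $\Lambda$). Set $\psi_p(s)=\ln(\lambda_p(\mathcal B(s)))/s$, $\Psi_p(s)=\sum_{i=1}^p\psi_i(s)$,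 $\underline\Psi_p=\liminf_{s\to+\infty}\Psi_p(s)$, $\overline\Psi_p=\limsup_{s\to+\infty}\Psi_p(s)$. *)

(* Defs.v *)
From mathcomp Require Import all_boot all_order all_algebra.
From mathcomp Require Import all_classical all_reals all_analysis.
Set Implicit Arguments.
Unset Strict Implicit.
Unset Printing Implicit Defensive.
Import Order.TTheory GRing.Theory Num.Theory.
Import numFieldNormedType.Exports.
Local Open Scope classical_set_scope.
Local Open Scope ring_scope.

Definition int_points (R : realType) (N : nat) : set 'cV[R]_N :=
  [set map_mx intr z | z in [set: 'cV[int]_N]].

Definition lattice_of_dim (R : realType) (N k : nat) (L : set 'cV[R]_N) : Prop :=
  exists B : 'M[R]_(N, k),
    \rank B = k /\ L = [set B *m z | z in @int_points R k].

(* The columns of P are the p linearly independent points.  The real-valued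
   [inf] of the empty set is 0, but the set below is nonempty as soon as L
   spans the space, M is a neighbourhood of the origin and p <= N. *)
Definition succ_min (R : realType) (N : nat) (L M : set 'cV[R]_N) (p : nat) : R :=
  inf [set lam : R | 0 < lam /\
        exists P : 'M[R]_(N, p), \rank P = p /\
          forall j, L (col j P) /\ [set lam *: v | v in M] (col j P)].

Section Exponents.
Variables (R : realType) (m n : nat) (Theta : 'M[R]_(n, m)).

Definition matT : 'M[R]_(m + n) := block_mx 1%:M 0 Theta 1%:M.

Definition Lambda : set 'cV[R]_(m + n) :=
  [set invmx matT *m z | z in @int_points R (m + n)].

Definition tau (s : R) : 'rV[R]_(m + n) :=
  row_mx (const_mx s) (const_mx (- (m%:R * s / n%:R))).

Definition unit_cube (N : nat) : set 'cV[R]_N :=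
  [set v | forall i, -1 <= v i 0 <= 1].

Definition boxB (s : R) : set 'cV[R]_(m + n) :=
  [set diag_mx (map_mx expR (tau s)) *m v | v in @unit_cube (m + n)].

Definition psi (p : nat) (s : R) : R := ln (succ_min Lambda (boxB s) p) / s.

Definition Psi (p : nat) (s : R) : R := \sum_(1 <= i < p.+1) psi i s.

(* Extended-real valued only because limf_einf and limf_esup are: for m, n > 0
   both limits are finite, since psi i stays bounded as s tends to +oo. *)
Definition Psi_inf (p : nat) : \bar R := limf_einf (fun s => (Psi p s)%:E) (pinfty_nbhs R).
Definition Psi_sup (p : nat) : \bar R := limf_esup (fun s => (Psi p s)%:E) (pinfty_nbhs R).

Definition integer_solutions : set 'cV[R]_(m + n) :=
  [set w | exists x y, [/\ @int_points R m x, @int_points R n y,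
                           Theta *m x = y & w = col_mx x y]].

End Exponents.

(* Main.v *)
Require Import Defs.
From mathcomp Require Import all_boot all_order all_algebra.
From mathcomp Require Import all_classical all_reals all_analysis.
From mathcomp Require Import ring lra zify.
Import Order.TTheory GRing.Theory Num.Theory.
Import numFieldNormedType.Exports.
Local Open Scope ring_scope.

(* For z = (x, y) put X z = |x| and Y z = |Theta x - y| (sup norms) and
   mu = m / n.  Then L_1(s) = ln (lambda_1 (B s)) is the minimum over z <> 0 of
   max (ln (X z) - s, ln (Y z) + mu s), a function with slopes -1 and mu.
   If Y never vanishes, consider a local minimum t of L_1, attained by a minimal
   point v, with psi_1 t close to liminf psi_1.  At the local maxima s' < t < s''
   next to it, the adjacent minimal points also attain L_1; each of them
   bounds L_2 t, giving
     L_1 t + L_2 t <= 2 L_1 t + (1 + mu) (t - s')   and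
     L_1 t + L_2 t <= 2 L_1 t + (1 + mu) (s'' - t),
   while L_1 s' <= b s' and L_1 s'' <= b s'' with b close to limsup psi_1 bound
   t - s' and s'' - t.  A crude form of Dirichlet's theorem gives
   limsup psi_1 < mu.  If Y vanishes somewhere, it vanishes at two independent
   points, and then psi_1 and psi_2 tend to -1. *)

(** * Lower and upper limits at +oo through real bounds *)

Section LimitsAtInfinity.
Context {R : realType}.
Implicit Types (f : R -> R) (a b c : R).

Local Notation liminf f := (limf_einf (fun s : R => (f s)%:E) (pinfty_nbhs R)).
Local Notation limsup f := (limf_esup (fun s : R => (f s)%:E) (pinfty_nbhs R)).

(** Every neighbourhood of +oo contains a ray, so the infimum of [f] over it is at most every e >
    c. *)
Lemma limf_einf_pinfty_le f c :
  (forall e, c < e -> forall S, exists2 t, S < t & f t < e) ->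
  (liminf f <= c%:E)%E.
Proof.
move=> freq; rewrite limf_einfE; apply: ge_ereal_sup => _ [V [S [_ VS]] <-].
apply/lee_addgt0Pr => e e0.
have [|t St ft] := freq (c + e) _ S; first by rewrite ltrDl.
apply: (@le_trans _ _ (f t)%:E); last by rewrite -EFinD lee_fin ltW.
by apply: ereal_inf_lbound; exists t => //; exact: VS.
Qed.

Lemma lt_limf_einf_pinfty f c :
  (c%:E < liminf f)%E -> exists S, forall t, S < t -> c < f t.
Proof.
rewrite limf_einfE => /ereal_sup_gt[_ [V [S [_ VS]] <-] cV].
exists S => t St; rewrite -lte_fin; apply: lt_le_trans cV _.
by apply: ereal_inf_lbound; exists t => //; exact: VS.
Qed.

Lemma limf_einf_pinfty_lt f c :
  (liminf f < c%:E)%E -> forall S, exists2 t, S < t & f t < c.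
Proof.
rewrite limf_einfE => fc S; apply: contrapT => nex.
move: fc; apply/negP; rewrite -leNgt; apply: ereal_sup_ge.
exists (ereal_inf [set (f t)%:E | t in [set t | S < t]]%classic).
  by exists [set t | S < t]%classic => //; exists S; split => //; exact: num_real.
apply/ereal_infP => _ [t St <-]; rewrite lee_fin leNgt.
by apply/negP => ftc; apply: nex; exists t.
Qed.

Lemma limf_esup_pinfty_lt f c :
  (limsup f < c%:E)%E -> exists S, forall t, S < t -> f t < c.
Proof.
rewrite limf_esupE => /ereal_inf_lt[_ [V [S [_ VS]] <-] cV].
exists S => t St; rewrite -lte_fin; apply: le_lt_trans cV.
by apply: ereal_sup_ubound; exists t => //; exact: VS.
Qed.

Lemma limf_esup_pinfty_le f c :
  (forall e, c < e -> exists S, forall t, S < t -> f t <= e) ->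
  (limsup f <= c%:E)%E.
Proof.
move=> ev; apply/lee_addgt0Pr => e e0; rewrite limf_esupE.
have [|S Sf] := ev (c + e); first by rewrite ltrDl.
apply: (@le_trans _ _ (ereal_sup [set (f t)%:E | t in [set t | S < t]]%classic)).
  apply: ereal_inf_lbound; exists [set t | S < t]%classic => //.
  by exists S; split => //; exact: num_real.
by apply: ge_ereal_sup => _ [t St <-]; rewrite -EFinD lee_fin Sf.
Qed.

Lemma limf_einf_pinfty_ge f c S :
  (forall t, S < t -> c <= f t) -> (c%:E <= liminf f)%E.
Proof.
move=> Sf; rewrite limf_einfE; apply: ereal_sup_ge.
exists (ereal_inf [set (f t)%:E | t in [set t | S < t]]%classic).
  by exists [set t | S < t]%classic => //; exists S; split => //; exact: num_real.
by apply/ereal_infP => _ [t St <-]; rewrite lee_fin Sf.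
Qed.

Lemma limf_einf_le_esup_pinfty f : (liminf f <= limsup f)%E.
Proof.
rewrite leNgt; apply/negP; rewrite limf_einfE limf_esupE.
move=> /ereal_inf_lt[_ [V [S [_ VS]] <-]] /ereal_sup_gt[_ [W [T [_ WT]] <-]].
apply/negP; rewrite -leNgt; set t := Num.max S T + 1.
have [St Tt] : S < t /\ T < t.
  by split; rewrite /t ltr_pwDr ?ltr01// le_max lexx ?orbT.
apply: (@le_trans _ _ (f t)%:E).
  by apply: ereal_inf_lbound; exists t => //; exact: WT.
by apply: ereal_sup_ubound; exists t => //; exact: VS.
Qed.

End LimitsAtInfinity.

(** * Sup norm and column rank *)

Section RealMatrices.
Context {R : realType}.

Definition supnorm {k} (v : 'cV[R]_k) : R := \big[Num.max/0]_i `|v i 0|.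

Lemma supnorm_ge0 {k} (v : 'cV[R]_k) : 0 <= supnorm v.
Proof. exact: bigmax_ge_id. Qed.

Lemma le_supnorm {k} (v : 'cV[R]_k) i : `|v i 0| <= supnorm v.
Proof. exact: (le_bigmax 0 (fun i => `|v i 0|)). Qed.

Lemma supnorm_leP {k} (v : 'cV[R]_k) a : 0 <= a ->
  reflect (forall i, `|v i 0| <= a) (supnorm v <= a).
Proof.
move=> a0; apply: (iffP idP) => [va i|va]; last exact/bigmax_leP.
exact: le_trans (le_supnorm v i) va.
Qed.

Lemma supnorm0_eq0 {k} (v : 'cV[R]_k) : supnorm v = 0 -> v = 0.
Proof.
move=> v0; apply/matrixP => i j; rewrite (ord1 j) mxE; apply/eqP.
by rewrite -normr_le0 -v0 le_supnorm.
Qed.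

Lemma supnorm0 {k} : supnorm (0 : 'cV[R]_k) = 0.
Proof.
by apply/le_anti; rewrite supnorm_ge0 andbT; apply/supnorm_leP => // i; rewrite mxE normr0.
Qed.

Lemma supnormZ_le {k} c (v : 'cV[R]_k) : supnorm (c *: v) <= `|c| * supnorm v.
Proof.
apply/supnorm_leP => [|i]; first by rewrite mulr_ge0 ?supnorm_ge0.
by rewrite mxE normrM ler_wpM2l ?le_supnorm.
Qed.

Lemma supnormZ {k} c (v : 'cV[R]_k) : supnorm (c *: v) = `|c| * supnorm v.
Proof.
apply/le_anti; rewrite supnormZ_le/=; have [->|c0] := eqVneq c 0.
  by rewrite normr0 mul0r supnorm_ge0.
rewrite -ler_pdivlMl ?normr_gt0// -normfV.
by rewrite -{1}[v](scalerK c0) supnormZ_le.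
Qed.

(** Turns a linear relation between two lattice points, block by block, into relations between their
    norms. *)
Lemma supnorm_addr_eq0 {k} a b (u v : 'cV[R]_k) :
  a *: u + b *: v = 0 -> `|a| * supnorm u = `|b| * supnorm v.
Proof.
move=> /eqP; rewrite addr_eq0 => /eqP uv.
by rewrite -supnormZ uv -scaleNr supnormZ normrN.
Qed.

Lemma rank_row_mx2 N (u v : 'cV[R]_N) :
  (forall a b, a *: u + b *: v = 0 -> a = 0 /\ b = 0) ->
  \rank (row_mx u v) = 2.
Proof.
move=> indep; rewrite -mxrank_tr; apply/eqP; rewrite -/(row_free _) -kermx_eq0.
apply/rowV0P => w /sub_kermxP wk.
have [|] := indep (w 0 (lshift 1 0)) (w 0 (rshift 1 0)).
  apply/matrixP => i j; rewrite (ord1 j) !mxE.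
  have := congr1 (fun M : 'rV[R]_N => M 0 i) wk.
  rewrite !mxE big_split_ord !big_ord1/= !mxE.
  by rewrite (unsplitK (inl _)) (unsplitK (inr _)).
move=> wl wr; apply/matrixP => i j; rewrite (ord1 i) mxE; rewrite -[j]splitK.
by case: (fintype.split j) => k; rewrite (ord1 k).
Qed.

Lemma rank1_cV N (v : 'cV[R]_N) : v != 0 -> \rank v = 1.
Proof. by move=> v0; rewrite -mxrank_tr rank_rV trmx_eq0 v0. Qed.

Lemma full_rank_col_neq0 {N p} (P : 'M[R]_(N, p)) j :
  \rank P = p -> col j P != 0.
Proof.
rewrite -mxrank_tr => /eqP Pfree; apply/eqP => cj.
have : row j P^T = 0 by rewrite -tr_col cj trmx0.
rewrite rowE => /eqP; rewrite mulmx_free_eq0// => /eqP/matrixP/(_ 0 j)/eqP.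
by rewrite !mxE !eqxx oner_eq0.
Qed.

End RealMatrices.

(** * Minimization over bounded sets of integer vectors *)

Section IntegerPoints.
Context {R : realType}.

Lemma bounded_int_argmin {N} (K : nat) (P : 'cV[int]_N -> Prop)
    (f : 'cV[int]_N -> R) z0 :
  P z0 -> (forall z, P z -> forall i, `|z i 0| <= K%:Z) ->
  exists2 z, P z & forall w, P w -> f z <= f w.
Proof.
move=> Pz0 PK.
(* Shifting each coordinate by [K] identifies the cube [-K, K]^N with a finite type, on which minima
   exist. *)
pose dec (g : {ffun 'I_N -> 'I_(K + K).+1}) : 'cV[int]_N :=
  \col_i ((g i : nat)%:Z - K%:Z).
have decP z : P z -> exists g, dec g = z.
  move=> Pz; exists [ffun i => inord `|(z i 0 + K%:Z)%R|%N].
  apply/matrixP => i j; rewrite (ord1 j) !mxE ffunE.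
  have zK := PK _ Pz i; rewrite inordK; lia.
have [g0 g0E] := decP _ Pz0.
have Pg0 : `[< P (dec g0) >] by apply/asboolP; rewrite g0E.
have [g /asboolP Pg gmin] :=
  arg_minP (P := fun g => `[< P (dec g) >]) (fun g => f (dec g)) Pg0.
exists (dec g) => // w Pw; have [h hE] := decP _ Pw.
by rewrite -hE; apply: gmin; apply/asboolP; rewrite hE.
Qed.

Lemma supnorm_int_ge1 {k} (z : 'cV[int]_k) :
  z != 0 -> 1 <= supnorm (map_mx intr z : 'cV[R]_k).
Proof.
move=> z0; have [i zi] : exists i, z i 0 != 0.
  apply: contrapT => nex; move/eqP: z0; apply; apply/matrixP => i j.
  rewrite (ord1 j) mxE; apply/eqP/negPn/negP => zi; apply: nex; by exists i.
apply: le_trans (le_supnorm _ i); rewrite mxE -intr_norm (ler_int _ 1).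
lia.
Qed.

End IntegerPoints.

(** * The lattice in the coordinates (x, y - Theta x) *)

Section Lattice.
Context {R : realType} {m n : nat} (Theta : 'M[R]_(n, m)).
Implicit Types z u v w : 'cV[int]_(m + n).

(** The pair ([xpart z], [rpart z]) is T^-1 z for z = (x, y), because T^-1 is T with Theta
    negated. *)
Definition xpart z : 'cV[R]_m := map_mx intr (usubmx z).
Definition rpart z : 'cV[R]_n := map_mx intr (dsubmx z) - Theta *m xpart z.
Definition lat_point z : 'cV[R]_(m + n) := col_mx (xpart z) (rpart z).
Definition xnorm z : R := supnorm (xpart z).
Definition rnorm z : R := supnorm (rpart z).

Lemma xnorm_ge0 z : 0 <= xnorm z. Proof. exact: supnorm_ge0. Qed.
Lemma rnorm_ge0 z : 0 <= rnorm z. Proof. exact: supnorm_ge0. Qed.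

Lemma matT_unit : matT Theta \in unitmx.
Proof. by rewrite unitmxE /matT det_lblock !det1 mulr1 unitr1. Qed.

Lemma matT_lat_point z : matT Theta *m lat_point z = map_mx intr z.
Proof.
rewrite /matT /lat_point mul_block_col !mul1mx mul0mx addr0 /rpart.
by rewrite addrCA subrr addr0 /xpart -map_col_mx vsubmxK.
Qed.

Lemma lat_pointE z : lat_point z = invmx (matT Theta) *m map_mx intr z.
Proof. by rewrite -matT_lat_point mulKmx// matT_unit. Qed.

Lemma Lambda_lat_point z : Lambda Theta (lat_point z).
Proof. by exists (map_mx intr z); [exists z|rewrite lat_pointE]. Qed.

Lemma LambdaP p : Lambda Theta p -> exists z, p = lat_point z.
Proof. by move=> [_ [z _ <-] <-]; exists z; rewrite lat_pointE. Qed.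

Lemma intr_inj_mx k (x y : 'cV[int]_k) :
  map_mx intr x = map_mx intr y :> 'cV[R]_k -> x = y.
Proof.
move=> xy; apply/matrixP => i j; apply: (@intr_inj R).
by have := congr1 (fun M : 'cV[R]_k => M i j) xy; rewrite !mxE.
Qed.

Lemma lat_point_eq0 z : (lat_point z == 0) = (z == 0).
Proof.
apply/eqP/eqP => [z0|->]; last by rewrite lat_pointE map_mx0 mulmx0.
by apply: intr_inj_mx; rewrite -matT_lat_point z0 mulmx0 map_mx0.
Qed.

Lemma xnorm_ge1 z : xnorm z != 0 -> 1 <= xnorm z.
Proof.
move=> x0; apply: supnorm_int_ge1; apply: contra_neq x0 => x0.
by rewrite /xnorm /xpart x0 map_mx0 supnorm0.
Qed.

(** When x = 0 the remainder y - Theta x is the integer vector y. *)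
Lemma rnorm_ge1 z : z != 0 -> xnorm z = 0 -> 1 <= rnorm z.
Proof.
move=> z0 /supnorm0_eq0 x0; rewrite /rnorm /rpart x0 mulmx0 subr0.
apply: supnorm_int_ge1; apply: contra_neq z0 => y0.
rewrite -[z]vsubmxK y0 (_ : usubmx z = 0) ?col_mx0//.
by apply: intr_inj_mx; rewrite -/(xpart z) x0 map_mx0.
Qed.

(** Since y = (y - Theta x) + Theta x, bounds on both norms bound every integer coordinate, so only
    finitely many points compete. All extremal points below are obtained this way. *)
Lemma bounded_argmin (P : 'cV[int]_(m + n) -> Prop) a b f z0 :
  P z0 -> (forall z, P z -> xnorm z <= a /\ rnorm z <= b) ->
  exists2 z, P z & forall w, P w -> f z <= f w :> R.
Proof.
move=> Pz0 Pab.
have a0 : 0 <= a by have [+ _] := Pab _ Pz0; exact: le_trans (xnorm_ge0 _).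
have b0 : 0 <= b by have [_] := Pab _ Pz0; exact: le_trans (rnorm_ge0 _).
pose C := a + (b + \sum_j \sum_k `|Theta j k| * a).
apply: (@bounded_int_argmin R _ (Num.truncn C).+1 _ _ z0) => // z Pz i.
have [Xa Yb] := Pab _ Pz.
have C0 : 0 <= \sum_j \sum_k `|Theta j k| * a.
  by apply: sumr_ge0 => j _; apply: sumr_ge0 => k _; rewrite mulr_ge0.
rewrite -(@ler_int R) intr_norm; apply: le_trans (ltW (truncnS_gt C)).
rewrite -[z]vsubmxK mxE; case: (fintype.split i) => j.
  have := le_trans (le_supnorm (xpart z) j) Xa; rewrite mxE /C; lra.
have Yj := le_trans (le_supnorm (rpart z) j) Yb.
have Tj : `|(Theta *m xpart z) j 0| <= \sum_j \sum_k `|Theta j k| * a.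
  rewrite (bigD1 j)//= mxE; apply: le_trans (ler_norm_sum _ _ _) _.
  apply: ler_wpDr.
    by apply: sumr_ge0 => l _; apply: sumr_ge0 => k _; rewrite mulr_ge0.
  apply: ler_sum => k _; rewrite normrM ler_wpM2l//.
  exact: le_trans (le_supnorm (xpart z) k) Xa.
rewrite -[(_ j 0)%:~R](@subrK _ ((Theta *m xpart z) j 0)).
apply: le_trans (ler_normD _ _) _; rewrite /C.
move: Yj; rewrite [rpart z j 0]mxE [X in `|_ + X|]mxE [map_mx _ _ j 0]mxE => Yj.
lra.
Qed.

End Lattice.

(** * Successive minima through integer vectors in dilated boxes *)

Section SuccessiveMinima.
Context {R : realType} {m n : nat} (Theta : 'M[R]_(n, m)).
Implicit Types (z u v w : 'cV[int]_(m + n)) (lam s : R).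

Local Notation X := (xnorm (R := R)).
Local Notation Y := (rnorm Theta).
Local Notation pt := (lat_point Theta).

Definition in_box lam s z : Prop :=
  X z <= lam * expR s /\ Y z <= lam * expR (- (m%:R * s / n%:R)).

Lemma scaled_boxP lam s z : 0 < lam ->
  [set lam *: v | v in boxB s]%classic (pt z) <-> in_box lam s z.
Proof.
move=> lam0; split=> [[_ [v cube <-] lamv]|[Xz Yz]].
  have vle i : `|pt z i 0| <= lam * expR (tau m n s 0 i).
    rewrite -lamv mul_diag_mx mxE [X in lam * X]mxE [map_mx _ _ _ _]mxE.
    rewrite normrM (gtr0_norm lam0) (ler_wpM2l (ltW lam0))//.
    rewrite normrM gtr0_norm ?expR_gt0// ler_piMr ?expR_ge0//.
    by rewrite ler_norml.
  split; (apply/supnorm_leP => [|i]; first by rewrite mulr_ge0 ?expR_ge0 ?ltW).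
    have := vle (lshift n i).
    by rewrite /lat_point /tau col_mxEu row_mxEl [const_mx _ _ _]mxE.
  have := vle (rshift m i).
  by rewrite /lat_point /tau col_mxEd row_mxEr [const_mx _ _ _]mxE.
have ptle i : `|pt z i 0| <= lam * expR (tau m n s 0 i).
  rewrite /lat_point /tau; case: (splitP i) => j ij.
    rewrite (_ : i = lshift n j); last exact: val_inj.
    rewrite col_mxEu row_mxEl [const_mx _ _ _]mxE.
    exact: le_trans (le_supnorm _ j) Xz.
  rewrite (_ : i = rshift m j); last exact: val_inj.
  rewrite col_mxEd row_mxEr [const_mx _ _ _]mxE.
  exact: le_trans (le_supnorm _ j) Yz.
pose v : 'cV[R]_(m + n) := \col_i ((lam * expR (tau m n s 0 i))^-1 * pt z i 0).
exists (diag_mx (map_mx expR (tau m n s)) *m v).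
  exists v => // i; rewrite -ler_norml mxE normrM normfV.
  have p0 : 0 < lam * expR (tau m n s 0 i) by rewrite mulr_gt0 ?expR_gt0.
  by rewrite (gtr0_norm p0) ler_pdivrMl// mulr1.
apply/matrixP => i j.
rewrite (ord1 j) mul_diag_mx mxE [X in lam * X]mxE [map_mx _ _ _ _]mxE [v i 0]mxE.
by rewrite mulrA mulVKf// mulf_neq0 ?gt_eqF ?expR_gt0.
Qed.

Definition independent_in_box p lam s : Prop :=
  exists2 P : 'M[R]_(m + n, p), \rank P = p &
    forall j, exists2 z, col j P = pt z & in_box lam s z.

Lemma succ_minE p s : succ_min (Lambda Theta) (boxB s) p =
  inf [set lam | 0 < lam /\ independent_in_box p lam s]%classic.
Proof.
congr inf; apply/seteqP; split=> lam [lam0].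
  move=> [P [Pp Pbox]]; split=> //; exists P => // j.
  have [/LambdaP[z zE]] := Pbox j; rewrite zE => /scaled_boxP-/(_ lam0) zbox.
  by exists z.
move=> [P Pp Pbox]; split=> //; exists P; split=> // j.
have [z -> zbox] := Pbox j.
by split; [exact: Lambda_lat_point|exact/scaled_boxP].
Qed.

Lemma independent_in_box1 lam s z :
  z != 0 -> in_box lam s z -> independent_in_box 1 lam s.
Proof.
move=> z0 zbox; exists (pt z) => [|j]; first by rewrite rank1_cV// lat_point_eq0.
by exists z => //; apply/matrixP => i k; rewrite (ord1 k) (ord1 j) !mxE.
Qed.

Lemma independent_in_box2 lam s u v :
  (forall a b, a *: pt u + b *: pt v = 0 -> a = 0 /\ b = 0) ->
  in_box lam s u -> in_box lam s v -> independent_in_box 2 lam s.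
Proof.
move=> uv ubox vbox.
exists (row_mx (pt u) (pt v) : 'M[R]_(m + n, 2)) => [|j]; first exact: rank_row_mx2.
have col0 w : col 0 (pt w) = pt w.
  by apply/matrixP => i k; rewrite (ord1 k) !mxE.
case: (@splitP 1 1 j) => k jk; [exists u|exists v] => //.
  have -> : j = lshift 1 k by exact: val_inj.
  by rewrite -[RHS]col0 -(ord1 k); exact: colKl.
have -> : j = rshift 1 k by exact: val_inj.
by rewrite -[RHS]col0 -(ord1 k); exact: colKr.
Qed.

Lemma independent_in_box_point p lam s : (0 < p)%N ->
  independent_in_box p lam s -> exists2 z, z != 0 & in_box lam s z.
Proof.
move=> p0 [P Pp /(_ (Ordinal p0))[z zE zbox]]; exists z => //.
by rewrite -(lat_point_eq0 Theta) -zE full_rank_col_neq0.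
Qed.

Lemma succ_min_le p lam s : 0 < lam -> independent_in_box p lam s ->
  succ_min (Lambda Theta) (boxB s) p <= lam.
Proof.
by move=> lam0 ind; rewrite succ_minE; apply: ge_inf => //; exists 0 => l -[/ltW].
Qed.

(** Each of p independent points is nonzero, so a lower bound for lambda_1 also bounds lambda_p. The
    witness [lam] makes the set nonempty; the real [inf] of the empty set would be 0. *)
Lemma succ_min_ge p mu lam s : (0 < p)%N -> 0 < lam -> independent_in_box p lam s ->
  (forall l z, 0 < l -> z != 0 -> in_box l s z -> mu <= l) ->
  mu <= succ_min (Lambda Theta) (boxB s) p.
Proof.
move=> p0 lam0 ind mule; rewrite succ_minE; apply: lb_le_inf; first by exists lam.
move=> l [l0 /(independent_in_box_point _ _ _ p0)[z z0 zbox]].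
exact: mule zbox.
Qed.

Lemma in_boxW lam lam' s z : lam <= lam' -> in_box lam s z -> in_box lam' s z.
Proof.
move=> le [Xz Yz]; split; [apply: le_trans Xz _|apply: le_trans Yz _];
by rewrite ler_wpM2r ?expR_ge0.
Qed.

Lemma ex_in_box s z : exists2 lam, 0 < lam & in_box lam s z.
Proof.
set a := X z * expR (- s); set b := Y z * expR (m%:R * s / n%:R).
have a0 : 0 <= a by rewrite mulr_ge0 ?xnorm_ge0 ?expR_ge0.
have b0 : 0 <= b by rewrite mulr_ge0 ?rnorm_ge0 ?expR_ge0.
exists (1 + a + b); first lra.
split; rewrite -ler_pdivrMr ?expR_gt0// -expRN ?opprK; first by rewrite -/a; lra.
by rewrite -/b; lra.
Qed.

Lemma ex_xnorm0 : (0 < n)%N -> exists z, [/\ z != 0, X z = 0 & Y z <= 1].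
Proof.
move=> n0; pose z : 'cV[int]_(m + n) := col_mx 0 (const_mx 1).
have x0 : xpart z = 0 :> 'cV[R]_m by rewrite /xpart col_mxKu map_mx0.
exists z; split.
- apply/eqP => /(congr1 (fun M : 'cV[int]_(m + n) => M (rshift m (Ordinal n0)) 0)).
  by rewrite col_mxEd !mxE.
- by rewrite /xnorm x0 supnorm0.
- apply/supnorm_leP => // i.
  by rewrite /rpart x0 mulmx0 subr0 col_mxKd !mxE normr1.
Qed.

Lemma succ_min1_lt lam s : (0 < n)%N ->
  succ_min (Lambda Theta) (boxB s) 1 < lam ->
  exists2 z, z != 0 & in_box lam s z.
Proof.
rewrite succ_minE => n0 /inf_lt[|l [l0 lind] llam].
  have [z [z0 _ _]] := ex_xnorm0 n0; have [l l0 zbox] := ex_in_box s z.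
  by exists l; split=> //; exact: independent_in_box1 zbox.
have [z z0 zbox] := independent_in_box_point 1 _ _ isT lind.
by exists z => //; apply: in_boxW zbox; exact: ltW.
Qed.

Lemma succ_min1_ge mu s : (0 < n)%N ->
  (forall l z, 0 < l -> z != 0 -> in_box l s z -> mu <= l) ->
  mu <= succ_min (Lambda Theta) (boxB s) 1.
Proof.
move=> n0; have [z [z0 _ _]] := ex_xnorm0 n0; have [l l0 zbox] := ex_in_box s z.
by apply: (succ_min_ge _ _ l) => //; exact: independent_in_box1 zbox.
Qed.

Lemma succ_min2_ge mu s u v :
  (forall a b, a *: pt u + b *: pt v = 0 -> a = 0 /\ b = 0) ->
  (forall l z, 0 < l -> z != 0 -> in_box l s z -> mu <= l) ->
  mu <= succ_min (Lambda Theta) (boxB s) 2.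
Proof.
move=> uv; have [k k0 ubox] := ex_in_box s u; have [l l0 vbox] := ex_in_box s v.
apply: (succ_min_ge _ _ (k + l)) => //; first exact: addr_gt0.
apply: (independent_in_box2 _ _ u v) => //.
  by apply: in_boxW ubox; rewrite lerDl ltW.
by apply: in_boxW vbox; rewrite lerDr ltW.
Qed.

(** If X z <> 0 then X z >= 1 and the first box inequality decides; otherwise Y z >= 1 and even lam
    >= 1. This yields psi_1 >= -1 and the positivity of the minima. *)
Lemma in_box_ge_expRN lam s z : 0 <= s -> z != 0 -> in_box lam s z ->
  expR (- s) <= lam.
Proof.
move=> s0 z0 [Xz Yz]; have [X0|X0] := eqVneq (X z) 0; last first.
  by rewrite -[expR _]mul1r expRN ler_pdivrMr ?expR_gt0// (le_trans (xnorm_ge1 _ X0)).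
have Y1 := le_trans (rnorm_ge1 _ _ z0 X0) Yz.
have lam0 : 0 <= lam by move: (xnorm_ge0 (R := R) z) Xz; rewrite X0 pmulr_lge0 ?expR_gt0.
have e1 : expR (- (m%:R * s / n%:R)) <= 1 :> R.
  by rewrite expR_le1 oppr_le0 divr_ge0 ?mulr_ge0.
have e2 : expR (- s) <= 1 by rewrite expR_le1 oppr_le0.
nra.
Qed.

(** A relation yields |a| X u = |b| X v and |a| Y u = |b| Y v. If b <> 0, the first forces |a| > |b|
    and then the second fails. *)
Lemma xnorm_rnorm_independent u v : X u < X v -> Y v < Y u ->
  forall a b, a *: pt u + b *: pt v = 0 -> a = 0 /\ b = 0.
Proof.
move=> Xuv Yvu a b; rewrite /lat_point !scale_col_mx add_col_mx => /eqP.
rewrite col_mx_eq0 => /andP[/eqP xE /eqP rE].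
have XE := supnorm_addr_eq0 _ _ _ _ xE; have YE := supnorm_addr_eq0 _ _ _ _ rE.
rewrite -/(X u) -/(X v) -/(Y u) -/(Y v) in XE YE.
have X0 := xnorm_ge0 (R := R) u; have Y0 := rnorm_ge0 Theta v.
have a0 := normr_ge0 a; have b0 := normr_ge0 b.
have {}b0 : b = 0.
  apply/eqP; rewrite -normr_eq0; apply: contraPT YE => bN0.
  have bgt0 : 0 < `|b| by rewrite lt_neqAle eq_sym bN0.
  have ab : `|b| < `|a| by rewrite ltNge; apply/negP => ab; nra.
  by apply/eqP; rewrite gt_eqF//; nra.
split=> //; apply/eqP; rewrite -normr_eq0.
move: YE; rewrite b0 normr0 mul0r => /eqP; rewrite mulf_eq0 => /orP[//|].
by rewrite gt_eqF// (le_lt_trans Y0).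
Qed.

End SuccessiveMinima.

(** * A weak form of Dirichlet's theorem *)

Section Dirichlet.
Context {R : realType} {m n : nat} (Theta : 'M[R]_(n, m)).
Implicit Types (z : 'cV[int]_(m + n)) (s : R).

Local Notation X := (xnorm (R := R)).
Local Notation Y := (rnorm Theta).

(** Pigeonhole on the multiples of the first unit vector by 0 <= q <= k^n: the fractional parts of q
    times the first column of Theta fall into k^n cells of side 1/k, and two multiples sharing a
    cell are subtracted. *)
Lemma dirichlet k : (0 < m)%N -> (0 < k)%N ->
  exists z, [/\ z != 0, X z <= k%:R ^+ n & Y z <= k%:R^-1].
Proof.
move=> m0; case: k => // k _; set K : R := k.+1%:R; have K0 : 0 < K by rewrite ltr0n.
pose i0 : 'I_m := Ordinal m0.
pose fl (q : nat) (j : 'I_n) : int := Num.floor (q%:R * Theta j i0).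
pose fr (q : nat) (j : 'I_n) : R := q%:R * Theta j i0 - (fl q j)%:~R.
have frP q j : 0 <= fr q j < 1.
  have := floor_le_tmp (q%:R * Theta j i0).
  have := floorD1_gt (q%:R * Theta j i0); rewrite /fr /fl intrD; lra.
pose f (q : 'I_(k.+1 ^ n).+1) : {ffun 'I_n -> 'I_k.+1} :=
  [ffun j => inord (Num.truncn (K * fr q j))].
have /injectivePn[q1 [q2 q12 fq]] : ~~ injectiveb f.
  by apply/injectiveP => /leq_card; rewrite card_ord card_ffun !card_ord ltnn.
wlog lt12 : q1 q2 q12 fq / (q1 < q2)%N.
  move=> W; case: (ltngtP q1 q2) => [|lt21|/val_inj E]; first exact: W.
    by apply: (W q2 q1) => //; rewrite eq_sym.
  by rewrite E eqxx in q12.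
have frlt j : `|fr q1 j - fr q2 j| <= K^-1.
  have [/andP[a0 a1] /andP[b0 b1]] := (frP q1 j, frP q2 j).
  have tlt q : (Num.truncn (K * fr q j) < k.+1)%N.
    have /andP[c0 c1] := frP q j.
    by rewrite truncn_lt_nat ?mulr_ge0 ?(ltW K0)// -/K; nra.
  have tE : Num.truncn (K * fr q1 j) = Num.truncn (K * fr q2 j).
    have := congr1 (fun g : {ffun 'I_n -> 'I_k.+1} => val (g j)) fq.
    by rewrite /= !ffunE !inordK.
  have /andP[] := truncn_itv (mulr_ge0 (ltW K0) a0).
  have /andP[] := truncn_itv (mulr_ge0 (ltW K0) b0).
  rewrite tE -(natr1 (Num.truncn _)) => u1 u2 v1 v2.
  rewrite -[K^-1]mul1r ler_pdivlMr// -[X in _ * X](gtr0_norm K0) -normrM ler_norml.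
  lra.
pose z : 'cV[int]_(m + n) := col_mx ((q2%:Z - q1%:Z) *: delta_mx i0 0)
  (\col_j (fl q2 j - fl q1 j)).
have xE : xpart z = (q2%:R - q1%:R) *: delta_mx i0 0 :> 'cV[R]_m.
  by rewrite /xpart col_mxKu map_mxZ map_delta_mx rmorphB.
have xz : X z = q2%:R - q1%:R.
  rewrite /xnorm xE; apply/le_anti; apply/andP; split.
    apply/supnorm_leP => [|i]; first by rewrite subr_ge0 ler_nat ltnW.
    rewrite !mxE normrM ger0_norm; last by rewrite subr_ge0 ler_nat ltnW.
    by case: (_ && _); rewrite ?normr1 ?normr0 ?mulr1 ?mulr0// subr_ge0 ler_nat ltnW.
  apply: le_trans (le_supnorm _ i0).
  by rewrite !mxE !eqxx mulr1 ler_norm.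
exists z; split.
- apply/eqP => z0; move: xz; rewrite z0 /xnorm /xpart linear0 map_mx0 supnorm0.
  by move/eqP; rewrite eq_sym subr_eq0 eqr_nat gtn_eqF.
- rewrite xz -natrX; apply: (@le_trans _ _ q2%:R); first by rewrite lerBlDr lerDl.
  by rewrite ler_nat -ltnS.
- apply/supnorm_leP => [|j]; first by rewrite invr_ge0 ltW.
  rewrite /rpart xE -scalemxAr -colE col_mxKd !mxE.
  have := frlt j; rewrite /fr intrB; congr (`|_| <= _); ring.
Qed.

Lemma small_rnorm e : (0 < m)%N -> 0 < e -> exists2 z, z != 0 & Y z < e.
Proof.
move=> m0 e0; have [//|z [z0 _ Yz]] := dirichlet (Num.truncn e^-1).+1 m0.
exists z => //; apply: le_lt_trans Yz _.
by rewrite invf_plt ?posrE// truncnS_gt.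
Qed.

(** Take k to be the integer part of exp (s / n): then k^n <= exp s, and rounding costs the factor 2
    in 1 / k <= 2 exp (- s / n). The growth rate (m - 1) / n is strictly below m / n. *)
Lemma succ_min1_le_dirichlet s : (0 < m)%N -> (0 < n)%N -> 0 <= s ->
  succ_min (Lambda Theta) (boxB s) 1 <= 2 * expR ((m%:R - 1) * s / n%:R).
Proof.
have expR_ge1 (x : R) : 0 <= x -> 1 <= expR x by move=> x0; rewrite -expR0 ler_expR.
move=> m0 n0 s0; have nR : 0 < n%:R :> R by rewrite ltr0n.
set E := expR (s / n%:R); have E1 : 1 <= E by rewrite expR_ge1// divr_ge0// ltW.
have k0 : (0 < Num.truncn E)%N by rewrite truncn_gt0.
have [z [z0 Xz Yz]] := dirichlet _ m0 k0.
have m1 : 0 <= m%:R - 1 :> R by rewrite subr_ge0 (ler_nat _ 1).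
have F1 : 1 <= expR ((m%:R - 1) * s / n%:R).
  by rewrite expR_ge1// divr_ge0 ?mulr_ge0// ltW.
apply: succ_min_le; first by rewrite mulr_gt0 ?expR_gt0.
apply: (independent_in_box1 _ _ _ z) => //.
have /andP[kE Ek] := truncn_itv (le_trans ler01 E1).
split.
  apply: le_trans Xz _; apply: (@le_trans _ _ (E ^+ n)).
    by rewrite lerXn2r ?nnegrE ?ler0n ?expR_ge0.
  rewrite /E -expRM_natl mulrCA divff ?gt_eqF// mulr1.
  by rewrite -[leLHS]mul1r ler_wpM2r ?expR_ge0//; lra.
apply: le_trans Yz _; rewrite -mulrA -expRD.
rewrite (_ : _ + _ = - (s / n%:R)); last by field; rewrite gt_eqF.
rewrite expRN -/E -[_^-1]mul1r ler_pdivrMr ?ltr0n// mulrAC.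
rewrite ler_pdivlMr ?mul1r; last lra.
move: Ek; rewrite -natr1; have : 1 <= (Num.truncn E)%:R :> R by rewrite (ler_nat _ 1).
by lra.
Qed.

End Dirichlet.

(** * Minimal points and the local extrema of L_1 *)

Section MinimalPoints.
Context {R : realType} {m n : nat} (Theta : 'M[R]_(n, m)).
Hypothesis (m_gt0 : (0 < m)%N) (n_gt0 : (0 < n)%N).
Implicit Types (u v w z : 'cV[int]_(m + n)) (s t : R).

Local Notation X := (xnorm (R := R)).
Local Notation Y := (rnorm Theta).
Local Notation mu := (m%:R / n%:R : R).
Local Notation L p s := (ln (succ_min (Lambda Theta) (boxB s) p)).

Let mu_gt0 : 0 < mu. Proof. by rewrite divr_gt0 ?ltr0n. Qed.

Lemma in_box_expR c s z :
  in_box Theta (expR c) s z <-> X z <= expR (c + s) /\ Y z <= expR (c - mu * s).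
Proof. by rewrite /in_box -!expRD mulrAC. Qed.

Lemma succ_min1_gt0 s : 0 <= s -> 0 < succ_min (Lambda Theta) (boxB s) 1.
Proof.
move=> s0; apply: (lt_le_trans (expR_gt0 (- s))).
by apply: succ_min1_ge => // l z _; exact: in_box_ge_expRN.
Qed.

Lemma ln_succ_min1_ge s : 0 <= s -> - s <= L 1 s.
Proof.
move=> s0; rewrite -[leLHS]expRK ler_ln ?posrE ?expR_gt0 ?succ_min1_gt0//.
by apply: succ_min1_ge => // l z _; exact: in_box_ge_expRN.
Qed.

Lemma ln_succ_min1_le c s z : 0 <= s -> z != 0 -> in_box Theta (expR c) s z ->
  L 1 s <= c.
Proof.
move=> s0 z0 zbox; rewrite -[leRHS]expRK ler_ln ?posrE ?expR_gt0 ?succ_min1_gt0//.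
by apply: succ_min_le; rewrite ?expR_gt0//; exact: independent_in_box1 zbox.
Qed.

Lemma ln_succ_min2_le c s u v : 0 <= s ->
  (forall a b, a *: lat_point Theta u + b *: lat_point Theta v = 0 -> a = 0 /\ b = 0) ->
  in_box Theta (expR c) s u -> in_box Theta (expR c) s v -> L 2 s <= c.
Proof.
move=> s0 uv ubox vbox.
(* Gives lambda_2 > 0; [ln] is monotone only on positive arguments. *)
have le2 : expR (- s) <= succ_min (Lambda Theta) (boxB s) 2.
  by apply: (succ_min2_ge _ _ _ _ _ uv) => l z _; exact: in_box_ge_expRN.
rewrite -[leRHS]expRK ler_ln ?posrE ?expR_gt0//.
  by apply: succ_min_le; rewrite ?expR_gt0//; exact: (independent_in_box2 _ _ _ u v).
exact: lt_le_trans (expR_gt0 _) le2.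
Qed.

(* The largest box [X < A, Y < D] free of nonzero lattice points touches
   the lattice at the parameter where both its sides correspond to the same
   dilation factor. *)
Lemma ln_succ_min1_gap A D s : 0 < A -> 0 < D -> 0 <= s ->
  (1 + mu) * s = ln A - ln D ->
  (forall z, z != 0 -> X z < A -> D <= Y z) -> ln A - s <= L 1 s.
Proof.
move=> A0 D0 s0 sE gap.
rewrite -[leLHS]expRK ler_ln ?posrE ?expR_gt0 ?succ_min1_gt0//.
apply: succ_min1_ge => // l z l0 z0 [Xz Yz]; rewrite leNgt; apply/negP => llt.
have Xlt : X z < A.
  apply: le_lt_trans Xz _; rewrite -ltr_pdivlMr ?expR_gt0// -expRN.
  by move: llt; rewrite expRD lnK.
have := le_trans (gap _ z0 Xlt) Yz; apply/negP; rewrite -ltNge.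
rewrite -ltr_pdivlMr ?expR_gt0// -expRN opprK; apply: lt_le_trans llt _.
rewrite -[X in _ <= X * _]lnK// -expRD ler_expR (mulrAC m%:R); lra.
Qed.

(** Pareto minimality of (X v, Y v) over the nonzero points. Ties in both norms are allowed, as v
    and -v always tie. *)
Definition minimal_point v : Prop := v != 0 /\
  forall w, w != 0 -> (X w < X v -> Y v < Y w) /\ (Y w < Y v -> X v < X w).

(** Lexicographic minimization in the box: first X, then Y among the points of least X. A competitor
    no worse in both norms lies in the box again. *)
Lemma ex_minimal_point lam s z0 : z0 != 0 -> in_box Theta lam s z0 ->
  exists2 v, minimal_point v & in_box Theta lam s v.
Proof.
move=> z00 zbox0.
have [v1 [v10 v1box] v1min] := bounded_argmin Theta
  (fun z => z != 0 /\ in_box Theta lam s z) _ _ X _ (conj z00 zbox0) (fun z => @proj2 _ _).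
have [v [v0 vbox Xv] vmin] := bounded_argmin Theta
  (fun z => [/\ z != 0, in_box Theta lam s z & X z = X v1])
  (lam * expR s) (lam * expR (- (m%:R * s / n%:R))) Y _
  (And3 v10 v1box (erefl _)) (fun z '(And3 _ b _) => b).
have le_box w : w != 0 -> X w <= X v -> Y w <= Y v -> w != 0 /\ in_box Theta lam s w.
  move=> w0 Xwv Ywv; case: vbox => Xb Yb; split=> //.
  by split; [exact: le_trans Xwv Xb|exact: le_trans Ywv Yb].
exists v => //; split=> // w w0; split=> ltwv; rewrite ltNge; apply/negP => lewv.
  have := v1min _ (le_box _ w0 (ltW ltwv) lewv).
  by rewrite -Xv leNgt ltwv.
have wbox := le_box _ w0 lewv (ltW ltwv).
have Xw : X w = X v1 by apply/le_anti; rewrite v1min// -Xv lewv.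
by have := vmin _ (And3 w0 (proj2 wbox) Xw); rewrite leNgt ltwv.
Qed.

(** [u] minimizes Y over the nonzero points with X < X v. The constraint Y <= 1 makes the search
    finite, and a point with x = 0 meets it because X v >= 1. *)
Lemma minimal_point_prev v : minimal_point v -> 1 <= X v ->
  exists u, [/\ u != 0, X u < X v, Y v < Y u, Y u <= 1 &
    forall z, z != 0 -> X z < X v -> Y u <= Y z].
Proof.
move=> [v0 vmin] Xv; have [z [z0 Xz Yz]] := ex_xnorm0 Theta n_gt0.
have [u [u0 Xu Yu] umin] := bounded_argmin Theta
  (fun z => [/\ z != 0, X z < X v & Y z <= 1]) (X v) 1 Y z
  (And3 z0 (eq_ind_r (fun x => x < X v) (lt_le_trans ltr01 Xv) Xz) Yz)
  (fun z '(And3 _ a b) => conj (ltW a) b).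
exists u; split=> // [|w w0 Xw]; first by case: (vmin _ u0) => /(_ Xu).
have [Yw|/ltW Yw] := leP (Y w) 1; first exact: umin.
exact: le_trans Yu Yw.
Qed.

(** [w] minimizes X over the nonzero points with Y < Y v, which exist by [small_rnorm]. *)
Lemma minimal_point_next v : minimal_point v -> 0 < Y v ->
  exists w, [/\ w != 0, X v < X w, Y w < Y v &
    forall z, z != 0 -> X z < X w -> Y v <= Y z].
Proof.
move=> [v0 vmin] Yv; have [z z0 Yz] := small_rnorm Theta _ m_gt0 Yv.
have [w [w0 Xw Yw] wmin] := bounded_argmin Theta
  (fun x => [/\ x != 0, X x <= X z & Y x < Y v]) (X z) (Y v) X z
  (And3 z0 (lexx _) Yz) (fun z '(And3 _ a b) => conj a (ltW b)).
exists w; split=> // [|x x0 xw]; first by case: (vmin _ w0) => _ /(_ Yw).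
rewrite leNgt; apply/negP => Yx.
have := wmin _ (And3 x0 (le_trans (ltW xw) Xw) Yx).
by rewrite leNgt xw.
Qed.

(** Only finitely many points have X <= q and Y <= 1, so Y has a positive minimum over the nonzero
    ones, if any. *)
Lemma xnorm_gt_of_small_rnorm q : (forall z, z != 0 -> 0 < Y z) ->
  exists2 delta, 0 < delta <= 1 & forall z, z != 0 -> Y z < delta -> q < X z.
Proof.
move=> Ypos; have [[z0 [z00 Xz0 Yz0]]|nex] :=
    pselect (exists z, [/\ z != 0, X z <= q & Y z <= 1]); last first.
  exists 1; rewrite ?ltr01 ?lexx// => z z0 Yz; rewrite ltNge; apply/negP => Xz.
  by apply: nex; exists z; split=> //; exact: ltW.
have [z [zn0 Xz Yz] zmin] := bounded_argmin Theta
  (fun z => [/\ z != 0, X z <= q & Y z <= 1]) q 1 Y z0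
  (And3 z00 Xz0 Yz0) (fun z '(And3 _ a b) => conj a b).
exists (Y z); first by rewrite Ypos.
move=> x x0 Yx; rewrite ltNge; apply/negP => Xx.
have := zmin _ (And3 x0 Xx (le_trans (ltW Yx) Yz)).
by rewrite leNgt Yx.
Qed.

(** [a] and [b] stand for numbers slightly above the lower and upper limits of psi_1; [g] is the
    value at [t] of the function of the minimal point, divided by t. *)
Lemma frequently_Psi2_bound a b S0 : (forall z, z != 0 -> 0 < Y z) ->
  a < mu -> -1 < b -> b < mu ->
  (forall S, exists2 s, S < s & psi Theta 1 s < a) ->
  (forall s, S0 < s -> psi Theta 1 s < b) ->
  forall S, exists t g, [/\ S < t, psi Theta 1 t <= g <= a,
    (1 + b) * (psi Theta 1 t + psi Theta 2 t) <= 2 * (1 + b) * g + (1 + mu) * (b - g) &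
    (mu - b) * (psi Theta 1 t + psi Theta 2 t) <= 2 * (mu - b) * g + (1 + mu) * (b - g)].
Proof.
move=> Ypos amu b1 bmu freq ev S.
pose S1 := Num.max 0 (Num.max S S0).
have [S1_0 S1_S S1_S0] : [/\ 0 <= S1, S <= S1 & S0 <= S1].
  by rewrite /S1; split; rewrite !le_max lexx ?orbT.
(* Y v < d will force ln (X v) > (1 + mu) S1, which puts [t] and both adjacent local maxima beyond
   [S1]. *)
have [d /andP[d0 d1] dX] := xnorm_gt_of_small_rnorm (expR ((1 + mu) * S1)) Ypos.
(* As a < mu, this threshold makes exp ((a - mu) s) < d. *)
have [s slt psia] := freq (Num.max 0 (ln d / (a - mu))).
move: slt; rewrite gt_max => /andP[s0 sd].
have Lpsi p t : 0 < t -> L p t = psi Theta p t * t.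
  by move=> t0; rewrite /psi divfK// gt_eqF.
have lam_lt : succ_min (Lambda Theta) (boxB s) 1 < expR (a * s).
  rewrite -[ltLHS]lnK ?posrE ?succ_min1_gt0 ?ltW// ltr_expR Lpsi//.
  by rewrite ltr_pM2r.
have [z z0 zbox] := succ_min1_lt Theta _ _ n_gt0 lam_lt.
have [v vmin /in_box_expR[Xv Yv]] := ex_minimal_point _ _ _ z0 zbox.
have [v0 _] := vmin; have Yv0 := Ypos _ v0.
have Yvd : Y v < d.
  apply: le_lt_trans Yv _; rewrite -[ltRHS]lnK ?posrE// ltr_expR -mulrBl mulrC.
  by rewrite -ltr_ndivrMr// subr_lt0.
have qX := dX _ v0 Yvd.
have X1 : 1 <= X v.
  apply: le_trans (ltW qX); rewrite -expR0 ler_expR mulr_ge0// addr_ge0// ltW//.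
have Xv0 : 0 < X v by lra.
set A := ln (X v); set D := ln (Y v).
have AS1 : (1 + mu) * S1 < A by rewrite -[ltLHS]expRK ltr_ln ?posrE ?expR_gt0.
have D0 : D < 0 by rewrite ln_lt0// Yv0 (lt_le_trans Yvd).
have Aa : A <= (a + 1) * s.
  by rewrite /A -[leRHS]expRK ler_ln ?posrE ?expR_gt0// mulrDl mul1r.
have Da : D <= (a - mu) * s.
  by rewrite /D -[leRHS]expRK ler_ln ?posrE ?expR_gt0// mulrBl.
(* [t] is the local minimum of [s |-> max (A - s) (D + mu * s)]. *)
pose t := (A - D) / (1 + mu).
have tE : (1 + mu) * t = A - D by rewrite mulrC divfK// gt_eqF// addr_gt0.
have tS1 : S1 < t by nra.
have t0 : 0 < t by lra.
pose g := (A - t) / t.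
have gE : g * t = A - t by rewrite divfK// gt_eqF.
have vbox c : g * t <= c -> in_box Theta (expR c) t v.
  move=> gc; apply/in_box_expR; rewrite -[X in X <= _]lnK// -[X in _ /\ X <= _]lnK//.
  by rewrite !ler_expR -/A -/D; split; nra.
have L1t : L 1 t <= g * t by apply: (ln_succ_min1_le _ _ v) (vbox _ _) => //; exact: ltW.
exists t, g; split.
- lra.
- apply/andP; split; first by rewrite -(ler_pM2r t0) -Lpsi.
  (* g t equals both A - t and D + mu t. For s <= t, g <= a follows from A <= (a + 1) s; for t < s,
     from D <= (a - mu) s and a < mu. *)
  rewrite -(ler_pM2r t0) gE; have [st|ts] := leP s t; first by nra.
  nra.
- have [u [u0 Xuv Yuv Yu1 gap]] := minimal_point_prev _ vmin X1.
  have Yu0 := lt_trans Yv0 Yuv; set E := ln (Y u).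
  have E0 : E <= 0 by exact: ln_le0.
  have DE : D < E by rewrite ltr_ln.
  (* Here the falling line A - s of v meets the rising line E + mu s of u; E <= 0 keeps s' > S1. The
     bound follows from (g + 1) t = A <= (1 + b) s' and E + mu t = g t + (1 + mu) (t - s'). *)
  pose s' := (A - E) / (1 + mu).
  have s'E : (1 + mu) * s' = A - E by rewrite mulrC divfK// gt_eqF// addr_gt0.
  have s'S1 : S1 < s' by nra.
  have s'S0 : S0 < s' by exact: le_lt_trans S1_S0 s'S1.
  have s'0 : 0 < s' by exact: le_lt_trans S1_0 s'S1.
  have L1s' : A - s' <= b * s'.
    apply: (@le_trans _ _ (L 1 s')).
      by apply: (ln_succ_min1_gap _ (Y u)) => //; exact: ltW.
    by rewrite Lpsi// ler_pM2r// ltW// ev.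
  have L2t : L 2 t <= E + mu * t.
    apply: (ln_succ_min2_le _ _ u v); first exact: ltW.
    + exact: xnorm_rnorm_independent.
    + apply/in_box_expR; split.
        apply: le_trans (ltW Xuv) _; rewrite -[leLHS]lnK// ler_expR -/A; lra.
      by rewrite -[leLHS]lnK// ler_expR -/E; lra.
    + apply: vbox; lra.
  rewrite -(ler_pM2r t0) [leLHS]mulrAC -mulrA mulrDl.
  move: L1t L2t; rewrite !Lpsi//; nra.
- have [w [w0 Xvw Ywv gap]] := minimal_point_next _ vmin Yv0.
  have Xw0 := lt_trans Xv0 Xvw; set E := ln (X w).
  have AE : A < E by rewrite ltr_ln.
  (* Here the rising line D + mu s of v meets the falling line E - s of w. The bound follows from
     (mu - b) s' <= - D = (mu - g) t and E - t = g t + (1 + mu) (s' - t). *)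
  pose s' := (E - D) / (1 + mu).
  have s'E : (1 + mu) * s' = E - D by rewrite mulrC divfK// gt_eqF// addr_gt0.
  have s't : t < s' by nra.
  have s'S0 : S0 < s' by exact: le_lt_trans S1_S0 (lt_trans tS1 s't).
  have s'0 : 0 < s' by exact: le_lt_trans S1_0 (lt_trans tS1 s't).
  have L1s' : E - s' <= b * s'.
    apply: (@le_trans _ _ (L 1 s')).
      by apply: (ln_succ_min1_gap _ (Y v)) => //; exact: ltW.
    by rewrite Lpsi// ler_pM2r// ltW// ev.
  have L2t : L 2 t <= E - t.
    apply: (ln_succ_min2_le _ _ v w); first exact: ltW.
    + exact: xnorm_rnorm_independent.
    + apply: vbox; lra.
    + apply/in_box_expR; split; first by rewrite -[leLHS]lnK// ler_expR -/E; lra.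
      apply: le_trans (ltW Ywv) _; rewrite -[leLHS]lnK// ler_expR -/D; lra.
  rewrite -(ler_pM2r t0).
  move: L1t L2t; rewrite !Lpsi//; nra.
Qed.

End MinimalPoints.

(* The limit [eps -> 0] in [h <= 2 g + K (b + eps - g) / p], with the denominator
   cleared. *)
Lemma cleared_bound_limit {R : realFieldType} (a b w K e r : R) :
  a <= b -> 0 < w -> 0 <= K -> 2 * a + K * (b - a) / w < e -> 0 < r ->
  exists eps, [/\ 0 < eps, eps < r & forall p g h, w - eps <= p ->
    a - eps <= g <= a + eps -> p * h <= 2 * p * g + K * (b + eps - g) -> h < e].
Proof.
move=> ab w0 K0 lte r0.
have Kw : 0 <= K * (b - a) / w by rewrite divr_ge0 ?mulr_ge0 ?subr_ge0// ltW.
pose E := e - 2 * a; have E0 : 0 < E by rewrite /E; lra.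
pose delta := w * E - K * (b - a).
have delta0 : 0 < delta.
  rewrite /delta subr_gt0 [ltRHS]mulrC -ltr_pdivrMr// /E; lra.
(* (w - eps) (E - 2 eps) - K (b - a + 2 eps) is at least delta - eps C, which is positive once 2 eps
   C <= delta. *)
pose C := E + 2 * w + 2 * K; have C0 : 0 < C by rewrite /C; lra.
pose eps := Num.min (Num.min r w) (Num.min E (delta / C)) / 2.
have dC : 0 < delta / C by rewrite divr_gt0.
have eps0 : 0 < eps by rewrite divr_gt0// !lt_min r0 w0 E0.
have [er ew eE ed] : [/\ 2 * eps <= r, 2 * eps <= w, 2 * eps <= E & 2 * eps <= delta / C].
  by rewrite mulrC divfK//; split; rewrite !ge_min lexx ?orbT.
exists eps; split=> //; first lra.
move=> p g h wp /andP[ga1 ga2] ph; rewrite ltNge; apply/negP => eh.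
have wp0 : 0 < w - eps by lra.
have ed' : 2 * eps * C <= delta by rewrite -ler_pdivlMr.
have le1 : (w - eps) * (E - 2 * eps) <= p * (h - 2 * g).
  by rewrite /E in eE *; apply: ler_pM; lra.
have le2 : K * (b + eps - g) <= K * (b - a + 2 * eps).
  by rewrite ler_wpM2l//; lra.
move: ed'; rewrite /delta /C; nra.
Qed.

(** * Solutions of Theta x = y and the passage to the limit *)

Section Conclusion.
Context {R : realType} {m n : nat} (Theta : 'M[R]_(n, m)).
Hypothesis (m_gt0 : (0 < m)%N) (n_gt0 : (0 < n)%N).
Implicit Types (u v w z : 'cV[int]_(m + n)) (s t : R).

Local Notation X := (xnorm (R := R)).
Local Notation Y := (rnorm Theta).
Local Notation pt := (lat_point Theta).
Local Notation mu := (m%:R / n%:R : R).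

Lemma integer_solutionsE :
  integer_solutions Theta = [set map_mx intr z | z in [set z | Y z = 0]]%classic.
Proof.
apply/seteqP; split=> [_ [_ [_ [[x _ <-] [y _ <-] xy ->]]]|_ [z Yz <-]].
  exists (col_mx x y); last by rewrite map_col_mx.
  by rewrite /= /rnorm /rpart /xpart col_mxKu col_mxKd xy subrr supnorm0.
exists (map_mx intr (usubmx z)), (map_mx intr (dsubmx z)); split.
- by exists (usubmx z).
- by exists (dsubmx z).
- by have /supnorm0_eq0/eqP := Yz; rewrite subr_eq0 => /eqP.
- by rewrite -map_col_mx vsubmxK.
Qed.

Lemma lat_point_linear q u v : pt (u - q *: v) = pt u - q%:~R *: pt v.
Proof.
by rewrite !lat_pointE map_mxB map_mxZ mulmxBr scalemxAr.
Qed.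

(** Let [w] be a nonzero solution of least X. If every solution were a real multiple of w, division
    with remainder would make it an integer multiple, and the solutions would form a one-dimensional
    lattice. *)
Lemma independent_solutions z0 : z0 != 0 -> Y z0 = 0 ->
  ~ lattice_of_dim 1 (integer_solutions Theta) ->
  exists u v, [/\ Y u = 0, Y v = 0, u != 0 &
    forall a b, a *: pt u + b *: pt v = 0 -> a = 0 /\ b = 0].
Proof.
move=> z00 Yz0 nlat.
have [w [w0 Xw Yw] wmin] := bounded_argmin Theta
  (fun z => [/\ z != 0, X z <= X z0 & Y z = 0]) (X z0) 0 X z0
  (And3 z00 (lexx _) Yz0)
  (fun z '(And3 _ a b) => conj a (eq_ind_r (fun y => y <= 0) (lexx 0) b)).
have ptw0 : pt w != 0 by rewrite lat_point_eq0.
have [prop|] := pselect (forall v, Y v = 0 -> exists c, pt v = c *: pt w); last first.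
  move=> /existsNP[v /not_implyP[Yv nprop]]; exists w, v; split=> // a b ab.
  have b0 : b = 0.
    apply: contrapT => /eqP b0; apply: nprop; exists (- (b^-1 * a)).
    apply: (scalerI b0); rewrite scalerA mulrN mulVKf// scaleNr.
    by apply/eqP; rewrite -addr_eq0 addrC ab.
  split=> //; move/eqP: ab; rewrite b0 scale0r addr0 scaler_eq0 (negbTE ptw0) orbF.
  by move/eqP.
case: nlat; exists (map_mx intr w); split.
  apply: rank1_cV; apply: contra w0 => /eqP w0.
  by apply/eqP; apply: (@intr_inj_mx R); rewrite w0 map_mx0.
rewrite integer_solutionsE; apply/seteqP; split=> [_ [v Yv <-]|_ [_ [k _ <-] <-]].
  have [c vE] := prop _ Yv; pose q := Num.floor c.
  exists (const_mx q%:~R); first by exists (const_mx q) => //; rewrite map_const_mx.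
  have dE : pt (v - q *: w) = (c - q%:~R) *: pt w.
    by rewrite lat_point_linear vE scalerBl.
  have [XE YE] : X (v - q *: w) = `|c - q%:~R| * X w /\ Y (v - q *: w) = `|c - q%:~R| * Y w.
    by move: dE; rewrite /lat_point scale_col_mx => /eq_col_mx[xE rE];
      rewrite /xnorm /rnorm xE rE !supnormZ.
  have frac : `|c - q%:~R| < 1.
    have := floor_le_tmp c; have := floorD1_gt c; rewrite -/q intrD => c1 c2.
    by rewrite ger0_norm ?subr_ge0//; lra.
  have Xw0 : 0 < X w.
    rewrite lt_neqAle xnorm_ge0 andbT eq_sym; apply/eqP => Xw0.
    by have := rnorm_ge1 Theta _ w0 Xw0; rewrite Yw ler10.
  (* The remainder is again a solution and has X < X w, so it vanishes by the choice of w. *)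
  have [d0|dn0] := eqVneq (v - q *: w) 0; last first.
    have Xd : X (v - q *: w) < X w by rewrite XE gtr_pMl.
    have := wmin _ (And3 dn0 (le_trans (ltW Xd) Xw) _).
    by rewrite YE Yw mulr0 leNgt Xd => /(_ erefl).
  move/eqP: d0; rewrite subr_eq0 => /eqP ->.
  by apply/matrixP => i j; rewrite (ord1 j) mxE big_ord1 !mxE intrM mulrC.
exists (k 0 0 *: w).
  rewrite /=; have := lat_point_linear (- k 0 0) 0 w.
  rewrite scaleNr opprK add0r => kE.
  have ptk : pt (k 0 0 *: w) = (k 0 0)%:~R *: pt w.
    rewrite kE (_ : pt 0 = 0) ?sub0r ?rmorphN ?scaleNr ?opprK//.
    by apply/eqP; rewrite lat_point_eq0.
  move: ptk; rewrite /lat_point scale_col_mx => /eq_col_mx[_ rE].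
  by rewrite /rnorm rE supnormZ -/(Y w) Yw mulr0.
by apply/matrixP => i j; rewrite (ord1 j) !mxE big_ord1 !mxE intrM mulrC.
Qed.

Lemma Psi1E s : Psi Theta 1 s = psi Theta 1 s.
Proof. by rewrite /Psi big_nat1. Qed.

Lemma Psi2E s : Psi Theta 2 s = psi Theta 1 s + psi Theta 2 s.
Proof. by rewrite /Psi big_nat_recr//= big_nat1. Qed.

Lemma psi1_ge s : 0 < s -> -1 <= psi Theta 1 s.
Proof.
by move=> s0; rewrite /psi ler_pdivlMr// mulN1r ln_succ_min1_ge// ltW.
Qed.

Lemma psi1_le s : 0 < s -> psi Theta 1 s <= (m%:R - 1) / n%:R + ln 2 / s.
Proof.
move=> s0; rewrite /psi ler_pdivrMr// mulrDl divfK ?gt_eqF//.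
rewrite (mulrAC _ _ s) addrC -[X in _ + X]expRK -lnM ?posrE ?expR_gt0//.
rewrite ler_ln ?posrE ?mulr_gt0 ?expR_gt0 ?succ_min1_gt0 ?(ltW s0)//.
by apply: succ_min1_le_dirichlet => //; exact: ltW.
Qed.

(** psi_1 lies between -1 and (m - 1) / n + ln 2 / s, so both limits are real numbers. *)
Lemma Psi1_limits : exists a b, [/\ Psi_inf Theta 1 = a%:E, Psi_sup Theta 1 = b%:E,
  -1 <= a, a <= b & b <= (m%:R - 1) / n%:R].
Proof.
have inf_ge : ((-1)%:E <= Psi_inf Theta 1)%E.
  by apply: (@limf_einf_pinfty_ge _ _ _ 0) => t t0; rewrite Psi1E psi1_ge.
have sup_le : (Psi_sup Theta 1 <= ((m%:R - 1) / n%:R)%:E)%E.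
  apply: limf_esup_pinfty_le => e lte; rewrite -subr_gt0 in lte.
  exists (Num.max 0 (ln 2 / (e - (m%:R - 1) / n%:R))) => t.
  rewrite gt_max => /andP[t0 tlt]; rewrite Psi1E; apply: le_trans (psi1_le _ t0) _.
  by rewrite -lerBrDl ler_pdivrMr// mulrC -ler_pdivrMr// ltW.
have inf_sup : (Psi_inf Theta 1 <= Psi_sup Theta 1)%E by exact: limf_einf_le_esup_pinfty.
move: inf_ge sup_le inf_sup.
case: (Psi_inf Theta 1) => [a| |]; case: (Psi_sup Theta 1) => [b| |] //=.
by rewrite !lee_fin => *; exists a, b.
Qed.

Lemma Psi_inf2_le_nosol a b : (forall z, z != 0 -> 0 < Y z) ->
  Psi_inf Theta 1 = a%:E -> Psi_sup Theta 1 = b%:E ->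
  -1 <= b -> a <= b -> b < mu ->
  (-1 < b -> (Psi_inf Theta 2 <= (2 * a + (1 + mu) * (b - a) / (1 + b))%:E)%E) /\
  (Psi_inf Theta 2 <= (2 * a + (1 + mu) * (b - a) / (mu - b))%:E)%E.
Proof.
move=> Ypos infE supE b1 ab bmu.
have mu0 : 0 <= mu by rewrite divr_ge0.
have K0 : 0 <= 1 + mu by rewrite addr_ge0.
(* [frequently_Psi2_bound] is applied to a + eps and b + eps; eps < mu - b keeps both below mu, and
   b + eps > -1 even if b = -1. *)
have good eps S : 0 < eps -> eps < mu - b -> exists t g,
    [/\ S < t, a - eps <= g <= a + eps,
    (1 + (b + eps)) * Psi Theta 2 t <=
      2 * (1 + (b + eps)) * g + (1 + mu) * (b + eps - g) &
    (mu - (b + eps)) * Psi Theta 2 t <=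
      2 * (mu - (b + eps)) * g + (1 + mu) * (b + eps - g)].
  move=> eps0 epsmu.
  have [S1 lowS1] : exists S1, forall t, S1 < t -> a - eps < Psi Theta 1 t.
    apply: lt_limf_einf_pinfty; rewrite -/(Psi_inf Theta 1) infE lte_fin; lra.
  have [S2 upS2] : exists S2, forall t, S2 < t -> Psi Theta 1 t < b + eps.
    apply: limf_esup_pinfty_lt; rewrite -/(Psi_sup Theta 1) supE lte_fin; lra.
  have freq S' : exists2 s, S' < s & psi Theta 1 s < a + eps.
    have lta : (Psi_inf Theta 1 < (a + eps)%:E)%E by rewrite infE lte_fin; lra.
    have [s Ss sa] := limf_einf_pinfty_lt _ _ lta S'.
    by exists s => //; rewrite -Psi1E.
  have up t : S2 < t -> psi Theta 1 t < b + eps by rewrite -Psi1E; exact: upS2.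
  have [amu b1' bmu'] : [/\ a + eps < mu, -1 < b + eps & b + eps < mu] by split; lra.
  have [t [g [St /andP[g1 g2] h1 h2]]] := frequently_Psi2_bound Theta m_gt0 n_gt0
    _ _ S2 Ypos amu b1' bmu' freq up (Num.max S S1).
  move: St; rewrite gt_max => /andP[St S1t].
  exists t, g; rewrite Psi2E; split=> //; rewrite g2 andbT.
  by apply: le_trans g1; rewrite -Psi1E ltW// lowS1.
(* The denominators are w + eps for w = 1 + b and w - eps for w = mu - b, both at least w - eps as
   [cleared_bound_limit] asks. *)
split=> [b1'|]; apply: limf_einf_pinfty_le => e lte S.
  have [||eps [eps0 epsr bound]] :=
    cleared_bound_limit a b (1 + b) (1 + mu) e (mu - b) ab _ K0 lte; [lra|lra|].
  have [t [g [St gE h1 _]]] := good eps S eps0 epsr.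
  by exists t => //; apply: bound gE h1; lra.
have [||eps [eps0 epsr bound]] :=
  cleared_bound_limit a b (mu - b) (1 + mu) e (mu - b) ab _ K0 lte; [lra|lra|].
have [t [g [St gE _ h2]]] := good eps S eps0 epsr.
by exists t => //; apply: bound gE h2; lra.
Qed.

Lemma in_box_solution s z : Y z = 0 -> 0 <= s -> z != 0 ->
  in_box Theta (expR (ln (X z) - s)) s z.
Proof.
move=> Yz s0 z0; have Xz : 0 < X z.
  rewrite lt_neqAle xnorm_ge0 andbT eq_sym; apply/eqP => Xz.
  by have := rnorm_ge1 Theta _ z0 Xz; rewrite Yz ler10.
by apply/in_box_expR; rewrite subrK lnK// Yz expR_ge0.
Qed.

(** Where Y vanishes only X constrains the box, so both minima are at most exp (M - s), and psi_1
    and psi_2 are at most -1 + M / s. *)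
Lemma Psi_sol u v : Y u = 0 -> Y v = 0 -> u != 0 ->
  (forall a b, a *: pt u + b *: pt v = 0 -> a = 0 /\ b = 0) ->
  (Psi_sup Theta 1 <= (-1)%:E)%E /\ (Psi_inf Theta 2 <= (-2)%:E)%E.
Proof.
move=> Yu Yv u0 uv.
have v0 : v != 0.
  apply/eqP => v0; have [|_ /eqP] := uv 0 1; last by rewrite oner_eq0.
  by rewrite scale0r add0r scale1r; apply/eqP; rewrite lat_point_eq0 v0.
pose M := Num.max (ln (X u)) (ln (X v)).
have psile p e t : (forall c, 0 <= t -> in_box Theta (expR c) t u ->
    in_box Theta (expR c) t v -> ln (succ_min (Lambda Theta) (boxB t) p) <= c) ->
    0 < e -> Num.max 0 (M / e) < t -> psi Theta p t <= -1 + e.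
  move=> Lle e0; rewrite gt_max => /andP[t0 Mt].
  rewrite /psi ler_pdivrMr//; apply: (@le_trans _ _ (M - t)).
    have boxM z : z != 0 -> Y z = 0 -> ln (X z) <= M -> in_box Theta (expR (M - t)) t z.
      move=> z0 Yz zM; apply: (in_boxW _ (expR (ln (X z) - t))).
        by rewrite ler_expR lerD2r.
      by apply: in_box_solution => //; exact: ltW.
    apply: Lle; first exact: ltW.
      by apply: boxM => //; rewrite le_max lexx.
    by apply: boxM => //; rewrite le_max lexx orbT.
  by rewrite mulrDl mulN1r addrC lerD2l mulrC -ler_pdivrMr// ltW.
have psi1le e t : 0 < e -> Num.max 0 (M / e) < t -> psi Theta 1 t <= -1 + e.
  by apply: psile => c t0 ubox _; exact: (ln_succ_min1_le _ _ _ _ u).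
split.
  apply: limf_esup_pinfty_le => e lte; exists (Num.max 0 (M / (e + 1))) => t tlt.
  by rewrite Psi1E (le_trans (psi1le _ _ _ tlt))//; lra.
(* Chosen so that 2 (-1 + e') < e, given e > -2. *)
apply: limf_einf_pinfty_le => e lte S; pose e' := (e + 2) / 3.
have e'0 : 0 < e' by rewrite /e'; lra.
pose t := Num.max S (Num.max 0 (M / e')) + 1.
have [St tlt] : S < t /\ Num.max 0 (M / e') < t.
  by rewrite /t; split; rewrite ltr_pwDr ?ltr01// le_max lexx ?orbT.
exists t => //; rewrite Psi2E.
have le1 := psi1le _ _ e'0 tlt.
have le2 : psi Theta 2 t <= -1 + e'.
  by apply: psile => // c t0; exact: ln_succ_min2_le.
by move: le1 le2 lte; rewrite /e'; lra.
Qed.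

End Conclusion.

Theorem theorem4 (R : realType) (m n : nat) (hm : (1 <= m)%N) (hn : (1 <= n)%N)
    (hd : (3 <= m + n)%N) (Theta : 'M[R]_(n, m))
    (hsol : ~ lattice_of_dim 1 (integer_solutions Theta)) :
  (Psi_sup Theta 1 <> (-1)%:E ->
    (Psi_inf Theta 2 <= 2%:E * Psi_inf Theta 1
       + (m + n)%:R%:E * ((Psi_sup Theta 1 - Psi_inf Theta 1)
                          / (n%:R%:E + n%:R%:E * Psi_sup Theta 1)))%E)
  /\
  (Psi_inf Theta 2 <= 2%:E * Psi_inf Theta 1
     + (m + n)%:R%:E * ((Psi_sup Theta 1 - Psi_inf Theta 1)
                        / (m%:R%:E - n%:R%:E * Psi_sup Theta 1)))%E.
Proof.
have [a [b [infE supE a1 ab bm]]] := Psi1_limits Theta hm hn.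
have n0 : 0 < n%:R :> R by rewrite ltr0n.
have m0 : 0 < m%:R :> R by rewrite ltr0n.
have bmu : b < m%:R / n%:R.
  by apply: le_lt_trans bm _; rewrite ltr_pM2r ?invr_gt0//; lra.
have den0 : 0 < m%:R - n%:R * b by rewrite subr_gt0 mulrC -ltr_pdivlMr.
have real_rhs D : D != 0 -> (2%:E * a%:E + (m + n)%:R%:E * ((b%:E - a%:E) / D%:E) =
    (2 * a + (m + n)%:R * ((b - a) / D))%:E)%E.
  by move=> D0; rewrite inver (negbTE D0) -EFinB -!EFinM -EFinD.
rewrite infE supE -!EFinM -EFinD -EFinB (real_rhs (m%:R - _)) ?gt_eqF//.
have [[z0 [z00 Yz0]]|nosol] := pselect (exists z, z != 0 /\ rnorm Theta z = 0).
  have [u [v [Yu Yv u0 uv]]] := independent_solutions Theta _ z00 Yz0 hsol.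
  have [] := Psi_sol Theta hn _ _ Yu Yv u0 uv; rewrite supE lee_fin => bN1 le2.
  have [aE bE] : a = -1 /\ b = -1 by split; lra.
  (* The first inequality is vacuous here, and the right-hand side of the second is -2 because b - a
     = 0. *)
  split; first by rewrite bE.
  apply: le_trans le2 _; rewrite lee_fin aE bE subrr mul0r mulr0; lra.
have Ypos z : z != 0 -> 0 < rnorm Theta z.
  move=> z0; rewrite lt_neqAle rnorm_ge0 andbT eq_sym; apply/eqP => Yz.
  by apply: nosol; exists z.
have [bd1 bd2] := Psi_inf2_le_nosol Theta hm hn _ _ Ypos infE supE (le_trans a1 ab) ab bmu.
split=> [bN1|].
  have b1 : -1 < b.
    rewrite lt_neqAle (le_trans a1 ab) andbT eq_sym; apply/eqP => bE.
    by apply: bN1; rewrite bE.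
  have d0 : 0 < 1 + b by lra.
  have nd0 : 0 < n%:R + n%:R * b by rewrite -[X in X + _]mulr1 -mulrDr mulr_gt0.
  (* With mu = m / n, d = n (1 + mu) gives d / (n + n b) = (1 + mu) / (1 + b); likewise d / (m - n
     b) = (1 + mu) / (mu - b) below. *)
  rewrite real_rhs ?gt_eqF//; apply: le_trans (bd1 b1) _; rewrite lee_fin lerD2l.
  rewrite le_eqVlt; apply/orP; left; apply/eqP; rewrite natrD; field.
  by rewrite !gt_eqF.
apply: le_trans bd2 _; rewrite lee_fin lerD2l.
rewrite le_eqVlt; apply/orP; left; apply/eqP; rewrite natrD; field.
by rewrite !gt_eqF// subr_gt0.
Qed.
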